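(* Let $N_1<N_2<\cdots$ be natural numbers, $\mathbf{N}=([N_s])_{s\in\mathbb{N}}$, and let $\mathcal{A}\subset\ell^\infty(\mathbb{Z})$ be a $C^*$-subalgebra that admits logarithmic averages along $\mathbf{N}$. Then the space $\mathcal{L}^2(\mathcal{A},\mathbf{N})$ is a Hilbert space with inner product $\langle[f]_\sim,[g]_\sim\rangle=\mathbb{E}^{\log}_{n\in\mathbf{N}}f(n)\overline{g(n)}$.
   Context: $[N]=\{1,\dots,N\}$; for finite nonempty $B\subset\mathbb{N}$, $\mathbb{E}^{\log}_{n\in B}f(n)=\big(\sum_{n\in B}f(n)/n\big)/\big(\sum_{n\in B}1/n\big)$, and $\mathbb{E}^{\log}_{n\in\mathbf{N}}f(n):=\lim_{s\to\infty}\mathbb{E}^{\log}_{n\in[N_s]}f(n)$. $\ell^\infty(\mathbb{Z})$ is the space of bounded functions $\mathbb{Z}\to\mathbb{C}$; a $C^*$-subalgebra is a sup-norm-closed subset containing $1_{\mathbb{Z}}$ closed under linear combinations, products and complex conjugation; it admits logarithmic averages along $\mathbf{N}$ if $\mathbb{E}^{\log}_{n\in\mathbf{N}}f(n)$ exists for every $f\in\mathcal{A}$. Define $\mathscr{L}^2(\mathcal{A},\mathbf{N})$ as the set of $f\colon\mathbb{Z}\to\mathbb{C}$ such that for every $\epsilon>0$ there is $g\in\mathcal{A}$ with $\limsup_{s\to\infty}\mathbb{E}^{\log}_{n\in[N_s]}|f(n)-g(n)|^2<\epsilon$. On it define $f\sim g$ iff $\mathbb{E}^{\log}_{n\in\mathbf{N}}|f(n)-g(n)|^2=0$,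 write $[f]_\sim$ for the class of $f$, and $\mathcal{L}^2(\mathcal{A},\mathbf{N})=\mathscr{L}^2(\mathcal{A},\mathbf{N})/\sim$, a complex vector space with operations induced by pointwise ones. *)

(* Defs.v *)
From HB Require Import structures.
From mathcomp Require Import all_boot all_order all_algebra.
From mathcomp Require Import generic_quotient ring_quotient sesquilinear complex.
From mathcomp Require Import lra.
From mathcomp Require Import all_classical all_reals.
From mathcomp Require Import topology normedtype ereal sequences.

Set Implicit Arguments.
Unset Strict Implicit.
Unset Printing Implicit Defensive.

Import Order.TTheory GRing.Theory Num.Theory numFieldNormedType.Exports.

Local Open Scope classical_set_scope.
Local Open Scope ring_scope.
Local Open Scope quotient_scope.

Notation normc := ComplexField.Normc.normc.

(* The logarithmic mean of f over [M] = {1, ..., M}. *)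
Definition logmean (K : numFieldType) (M : nat) (f : int -> K) : K :=
  (\sum_(1 <= n < M.+1) f n%:Z / n%:R) / (\sum_(1 <= n < M.+1) n%:R^-1).

Section Cstar.
Variable R : realType.
Implicit Types (f g : int -> R[i]) (N : nat -> nat) (A : set (int -> R[i])).

(* The topology on the complex numbers is carried by R[i]^o in the library. *)
Definition logmean_cvg N f (l : R[i]) :=
  (fun s => logmean (N s) f : R[i]^o) @ \oo --> (l : R[i]^o).

Definition linfty : set (int -> R[i]) :=
  [set f | exists M : R, forall n, normc (f n) <= M].

Definition supnorm f : R := sup (range (fun n => normc (f n))).

Record Cstar_subalgebra A : Prop := CstarSubalgebra {
  Cstar_bounded : A `<=` linfty;
  Cstar_one : A (fun=> 1);
  Cstar_lin : forall (a b : R[i]) f g, A f -> A g ->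
    A (fun n => a * f n + b * g n);
  Cstar_mul : forall f g, A f -> A g -> A (fun n => f n * g n);
  Cstar_conj : forall f, A f -> A (fun n => (f n)^*);
  Cstar_closed : forall f, linfty f ->
    (forall e : R, 0 < e -> exists2 g, A g & supnorm (fun n => f n - g n) < e) ->
    A f }.

Definition admits_log_averages A N :=
  forall f, A f -> exists l, logmean_cvg N f l.

Definition is_L2 A N f := forall e : R, 0 < e ->
  exists2 g, A g &
    (limn_esup (fun s =>
       (logmean (N s) (fun n => normc (f n - g n) ^+ 2))%:E) < e%:E)%E.

Definition is_null N f :=
  (fun s => logmean (N s) (fun n => normc (f n) ^+ 2)) @ \oo --> (0 : R).

End Cstar.

Section Lemmas.
Variable R : realType.
Implicit Types (f g : int -> R[i]) (N : nat -> nat) (A : set (int -> R[i])).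

Lemma normc_sqZD (a b x y : R[i]) :
  normc (a * x + b * y) ^+ 2 <=
  (2 * normc a ^+ 2) * normc x ^+ 2 + (2 * normc b ^+ 2) * normc y ^+ 2.
Proof.
have h (z : R[i]) : normc z ^+ 2 = complex.Re z ^+ 2 + complex.Im z ^+ 2.
  by case: z => u v /=; rewrite sqr_sqrtr// addr_ge0// sqr_ge0.
have hM (u v : R[i]) : normc (u * v) ^+ 2 = normc u ^+ 2 * normc v ^+ 2.
  by rewrite ComplexField.Normc.normcM exprMn.
have hD (u v : R[i]) : normc (u + v) ^+ 2 <= 2 * normc u ^+ 2 + 2 * normc v ^+ 2.
  rewrite !h; case: u v => [u1 u2] [v1 v2] /=.
  have := sqr_ge0 (u1 - v1); have := sqr_ge0 (u2 - v2).
  by rewrite !expr2; nra.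
by have := hD (a * x) (b * y); rewrite !hM !mulrA.
Qed.

Lemma logmean_ge0 M (f : int -> R) : (forall n, 0 <= f n) -> 0 <= logmean M f.
Proof.
move=> f0; rewrite /logmean divr_ge0// sumr_ge0// => i _;
  by rewrite ?divr_ge0// invr_ge0.
Qed.

Lemma le_logmean M (f g : int -> R) : (forall n, f n <= g n) ->
  logmean M f <= logmean M g.
Proof.
move=> fg; rewrite /logmean ler_wpM2r//.
  by rewrite invr_ge0 sumr_ge0// => i _; rewrite invr_ge0.
by apply: ler_sum => i _; rewrite ler_wpM2r// invr_ge0.
Qed.

Lemma logmeanZD M (a b : R) (f g : int -> R) :
  logmean M (fun n => a * f n + b * g n) = a * logmean M f + b * logmean M g.
Proof.
rewrite /logmean !mulrA -mulrDl; congr (_ / _).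
rewrite !mulr_sumr -big_split/=; apply: eq_bigr => i _.
by rewrite mulrDl !mulrA.
Qed.

Lemma logmean_sqZD M (a b : R[i]) f g :
  logmean M (fun n => normc (a * f n + b * g n) ^+ 2) <=
  2 * normc a ^+ 2 * logmean M (fun n => normc (f n) ^+ 2) +
  2 * normc b ^+ 2 * logmean M (fun n => normc (g n) ^+ 2).
Proof. by rewrite -logmeanZD le_logmean// => n; exact: normc_sqZD. Qed.

Lemma limn_esup_lt_near (u : (\bar R)^nat) (c : \bar R) :
  (limn_esup u < c)%E -> \forall s \near \oo, (u s < c)%E.
Proof.
rewrite limn_esup_lim => h.
have cl : esups u @ \oo --> limn (esups u) by exact: is_cvg_esups.
have : \forall s \near \oo, (esups u s < c)%E.
  apply: (cl [set x | (x < c)%E]); apply: open_nbhs_nbhs; split => //.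
  exact: open_ereal_lt_ereal.
apply: filterS => s; apply: le_lt_trans.
by apply: ereal_sup_ubound; exists s => //=.
Qed.

Lemma limn_esup_le_near (u : (\bar R)^nat) (c : \bar R) :
  (\forall s \near \oo, (u s <= c)%E) -> (limn_esup u <= c)%E.
Proof.
case=> n _ hn; rewrite limn_esup_lim.
apply: lime_le; first exact: is_cvg_esups.
exists n => // m /= nm; apply: ge_ereal_sup => _ [k /= mk <-].
by apply: hn => /=; exact: leq_trans mk.
Qed.

Lemma is_L2_lin A N (hA : Cstar_subalgebra A) (a b : R[i]) f g :
  is_L2 A N f -> is_L2 A N g -> is_L2 A N (fun n => a * f n + b * g n).
Proof.
move=> hf hg e e0.
pose ca := 2 * normc a ^+ 2 + 1; pose cb := 2 * normc b ^+ 2 + 1.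
have a0 : 0 <= 2 * normc a ^+ 2 by rewrite mulr_ge0// sqr_ge0.
have b0 : 0 <= 2 * normc b ^+ 2 by rewrite mulr_ge0// sqr_ge0.
have ca0 : 0 < ca by rewrite /ca; lra.
have cb0 : 0 < cb by rewrite /cb; lra.
have [|f' Af' /limn_esup_lt_near lf] := hf (e / 4 / ca).
  by rewrite !divr_gt0.
have [|g' Ag' /limn_esup_lt_near lg] := hg (e / 4 / cb).
  by rewrite !divr_gt0.
exists (fun n => a * f' n + b * g' n); first exact: Cstar_lin.
apply: (@le_lt_trans _ _ (e / 2)%:E); last by rewrite lte_fin; lra.
apply: limn_esup_le_near; apply: filterS2 lf lg => s.
rewrite !lte_fin lee_fin => lf lg.
under [X in logmean _ X]eq_fun => n.
  rewrite (_ : _ - _ = a * (f n - f' n) + b * (g n - g' n)); last first.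
    by rewrite !mulrBr opprD addrACA.
  over.
apply: (le_trans (logmean_sqZD _ _ _ (fun n => f n - f' n) (fun n => g n - g' n))).
rewrite ltr_pdivlMr// in lf; rewrite ltr_pdivlMr// in lg.
have uf : 0 <= logmean (N s) (fun n => normc (f n - f' n) ^+ 2).
  by apply: logmean_ge0 => n; rewrite sqr_ge0.
have ug : 0 <= logmean (N s) (fun n => normc (g n - g' n) ^+ 2).
  by apply: logmean_ge0 => n; rewrite sqr_ge0.
by rewrite /ca in lf; rewrite /cb in lg; nra.
Qed.

Lemma normc0 : normc (0 : R[i]) = 0.
Proof. exact: ComplexField.Normc.normc0. Qed.

Lemma is_null_lin N (a b : R[i]) f g : is_null N f -> is_null N g ->
  is_null N (fun n => a * f n + b * g n).
Proof.
move=> hf hg.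
have h : (fun s => 2 * normc a ^+ 2 * logmean (N s) (fun n => normc (f n) ^+ 2) +
    2 * normc b ^+ 2 * logmean (N s) (fun n => normc (g n) ^+ 2)) @ \oo --> (0 : R).
  rewrite [X in _ --> X](_ : 0 = 2 * normc a ^+ 2 * 0 + 2 * normc b ^+ 2 * 0 :> R).
    apply: cvgD; apply: cvgM; [exact: cvg_cst|exact: hf|exact: cvg_cst|exact: hg].
  by rewrite !mulr0 addr0.
apply: (squeeze_cvgr _ (cvg_cst _) h); apply: nearW => s; apply/andP; split.
  by apply: logmean_ge0 => n; rewrite sqr_ge0.
exact: logmean_sqZD.
Qed.

Lemma is_null0 N : is_null N (0 : int -> R[i]).
Proof.
rewrite /is_null (_ : (fun _ => _) = cst 0); first exact: cvg_cst.
apply/funext => s; rewrite /logmean big1 ?mul0r// => i _.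
by rewrite normc0 expr0n mul0r.
Qed.

End Lemmas.

Section L2.
Variables (R : realType) (A : set (int -> R[i])) (N : nat -> nat).
Hypothesis hA : Cstar_subalgebra A.

(* The unused argument lets the closure instance below depend on hA. *)
Definition L2_pred of Cstar_subalgebra A : {pred int -> R[i]} :=
  fun f => `[< is_L2 A N f >].

Lemma L2_submod_closed : submod_closed (L2_pred hA).
Proof.
split.
  apply/asboolP => e e0; exists (fun=> 0).
    have := Cstar_lin hA 0 0 (Cstar_one hA) (Cstar_one hA).
    by under eq_fun => n do rewrite !mul0r addr0.
  apply: le_lt_trans (_ : 0 < e%:E)%E; last by rewrite lte_fin.
  apply: limn_esup_le_near; apply: nearW => s.
  rewrite lee_fin /logmean big1 ?mul0r// => i _.
  by rewrite subrr normc0 expr0n mul0r.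
move=> a f g /asboolP hf /asboolP hg; apply/asboolP.
have := is_L2_lin hA a 1 hf hg.
by under eq_fun => n do rewrite mul1r.
Qed.

HB.instance Definition _ :=
  GRing.isSubmodClosed.Build R[i] (int -> R[i]) (L2_pred hA) L2_submod_closed.

(* Script L^2(A, N); its quotient [L2] below is calligraphic L^2(A, N). *)
Record preL2 := PreL2 { preL2_val :> int -> R[i]; _ : preL2_val \in L2_pred hA }.

HB.instance Definition _ := [isSub for preL2_val].
HB.instance Definition _ := [Choice of preL2 by <:].
HB.instance Definition _ := [SubChoice_isSubLmodule of preL2 by <:].

Definition null_pred : {pred preL2} := fun f => `[< is_null N f >].

Lemma null_submod_closed : submod_closed null_pred.
Proof.
split; first by apply/asboolP; exact: is_null0.
move=> a f g /asboolP hf /asboolP hg; apply/asboolP.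
have := is_null_lin a 1 hf hg.
by under eq_fun => n do rewrite mul1r.
Qed.

HB.instance Definition _ :=
  GRing.isSubmodClosed.Build R[i] preL2 null_pred null_submod_closed.

(* The quotient by the relation [f - g \in null_pred], that is, f ~ g iff the
   logarithmic average of |f - g|^2 along N is 0. *)
Definition L2 := Quotient.quot null_pred.

HB.instance Definition _ := GRing.Zmodule.on L2.
HB.instance Definition _ := EqQuotient.on L2.

Definition L2_class (f : preL2) : L2 := \pi_L2 f.

Lemma L2_class_eq f g : L2_class f = L2_class g <->
  is_null N (fun n => preL2_val f n - preL2_val g n).
Proof.
split.
  by move=> /eqmodP; rewrite /= => /asboolP.
by move=> h; apply/eqmodP; apply/asboolP.
Qed.

Lemma L2_classD f g : L2_class (f + g) = L2_class f + L2_class g.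
Proof. exact: Quotient.pi_add. Qed.

Lemma L2_classP (x : L2) : exists f, L2_class f = x.
Proof. by exists (repr x); exact: reprK. Qed.

Definition L2_scale (a : R[i]) (x : L2) : L2 := L2_class (a *: repr x).

Lemma L2_classZ a f : L2_class (a *: f) = L2_scale a (L2_class f).
Proof.
apply/eqmodP; rewrite /= /Quotient.equiv -scalerBr; apply: rpredZ.
have : L2_class f = L2_class (repr (L2_class f)) by rewrite /L2_class reprK.
by move=> /eqmodP.
Qed.

Lemma L2_scaleA a b x : L2_scale a (L2_scale b x) = L2_scale (a * b) x.
Proof. by have [f <-] := L2_classP x; rewrite -!L2_classZ scalerA. Qed.

Lemma L2_scale1 : left_id 1 L2_scale.
Proof. by move=> x; have [f <-] := L2_classP x; rewrite -L2_classZ scale1r. Qed.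

Lemma L2_scaleDr : right_distributive L2_scale +%R.
Proof.
move=> a x y; have [f <-] := L2_classP x; have [g <-] := L2_classP y.
by rewrite -L2_classD -!L2_classZ scalerDr L2_classD.
Qed.

Lemma L2_scaleDl x : {morph L2_scale^~ x : a b / a + b}.
Proof.
move=> a b; have [f <-] := L2_classP x.
by rewrite -!L2_classZ scalerDl L2_classD.
Qed.

HB.instance Definition _ := GRing.Zmodule_isLmodule.Build R[i] L2
  L2_scaleA L2_scale1 L2_scaleDr L2_scaleDl.

End L2.

Section Hilbert.
Variables (R : realType) (V : lmodType R[i]).

Definition dot_norm (ip : {dot V for (@Num.conj R[i])}) (x : V) : R :=
  Num.sqrt (complex.Re (ip x x)).

(* A Hilbert space is an inner product space (the type of ip) that is complete
   for the norm of its inner product. *)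
Definition hilbert (ip : {dot V for (@Num.conj R[i])}) : Prop :=
  forall u : nat -> V,
    (forall e : R, 0 < e -> exists n0, forall m n, (n0 <= m)%N -> (n0 <= n)%N ->
      dot_norm ip (u m - u n) < e) ->
    exists l : V, (fun n => dot_norm ip (u n - l)) @ \oo --> (0 : R).

End Hilbert.

(* Main.v *)
(** Logarithmic means of [|f|^2] converge for [f] in L^2(A, N), because they are
    eventually close to those of [|g|^2] for an approximating [g] in [A], for which
    [|g|^2] is again in [A]; polarization then gives the inner product. For
    completeness, pick a subsequence [f_j] such that the means of [|f_j - f_k|^2] are
    eventually at most [1/(k+1)] for [j >= k], and glue it into one function
    equal to [f_j] on the [j]-th of a sequence of rapidly growing blocks of
    integers: it is the limit. *)

Require Import Defs.
From HB Require Import structures.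
From mathcomp Require Import all_boot all_order all_algebra.
From mathcomp Require Import generic_quotient ring_quotient sesquilinear complex.
From mathcomp Require Import ring lra zify.
From mathcomp Require Import all_classical all_reals.
From mathcomp Require Import topology normedtype ereal sequences.

Set Implicit Arguments.
Unset Strict Implicit.
Unset Printing Implicit Defensive.

Import Order.TTheory GRing.Theory Num.Theory numFieldNormedType.Exports.
Local Open Scope classical_set_scope.
Local Open Scope ring_scope.

(** * Logarithmic weights and gluing along sparse stages *)

Section Glue.
Variable R : realType.
Implicit Types (f : int -> R) (N : nat -> nat).

Definition logsum (M : nat) f : R := \sum_(1 <= n < M.+1) f n%:Z / n%:R.

Definition logweight (M : nat) : R := \sum_(1 <= n < M.+1) n%:R^-1.

Lemma logweight_gt0 M : (0 < M)%N -> 0 < logweight M.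
Proof.
move=> M0; rewrite /logweight big_nat_recl//= ltr_wpDr ?invr_gt0//.
by apply: sumr_ge0 => i _; rewrite invr_ge0.
Qed.

Lemma logmean_leE M f c : (0 < M)%N ->
  (logmean M f <= c) = (logsum M f <= c * logweight M).
Proof. by move=> M0; rewrite /logmean ler_pdivrMr// logweight_gt0. Qed.

Lemma cvg_logweight : logweight @ \oo --> +oo.
Proof.
have -> : logweight = series (@harmonic R).
  by apply/funext => M; rewrite /logweight /series/= big_add1.
apply: nondecreasing_dvgn_lt; last exact: dvg_harmonic.
apply/nondecreasing_seqP => n; rewrite /series/= big_nat_recr//= lerDl.
by rewrite invr_ge0.
Qed.

Lemma logsum_cat M M' f : (M <= M')%N ->
  logsum M' f = logsum M f + \sum_(M.+1 <= n < M'.+1) f n%:Z / n%:R.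
Proof. by move=> MM'; rewrite /logsum (big_cat_nat (n := M.+1)). Qed.

(** Beyond [M] the terms are those of [g], and completing that tail to the full sum only adds
    nonnegative terms. *)
Lemma logsum_tail_le M M' f g : (M <= M')%N -> (forall n, 0 <= g n) ->
  (forall n : nat, (M < n <= M')%N -> f n%:Z = g n%:Z) ->
  logsum M' f <= logsum M f + logsum M' g.
Proof.
move=> MM' g0 fg; rewrite (logsum_cat f MM') (logsum_cat g MM') lerD2l.
rewrite ler_wpDl//; first by apply: sumr_ge0 => i _; rewrite divr_ge0.
by apply: ler_sum_nat => i ?; rewrite fg.
Qed.

(** Recursive choice: each stage is taken past the previous one and past the thresholds after which
    [P] and [h] hold. *)
Lemma stages (P : nat -> nat -> Prop) (h : nat -> nat -> Prop) :
  (forall j, \forall s \near \oo, P j s) ->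
  (forall s, \forall t \near \oo, h s t) ->
  exists S : nat -> nat, [/\ forall j s, (S j <= s)%N -> P j s,
    forall j, (S j < S j.+1)%N & forall j, h (S j) (S j.+1)].
Proof.
move=> nP nh.
have /choice[F hF] (p : nat * nat) : exists t, [/\ forall s, (t <= s)%N -> P p.1 s,
    (p.2 < t)%N & h p.2 t].
  case: p => j s /=; have [a _ ha] := nP j; have [b _ hb] := nh s.
  exists (maxn (maxn a b) s.+1); split.
  - by move=> t /= ?; apply: ha => /=; lia.
  - by lia.
  - by apply: hb => /=; lia.
pose fix S j := if j is j'.+1 then F (j, S j') else F (0%N, 0%N).
exists S; split.
- by case=> [|j]; [have [] := hF (0%N, 0%N)|have [] := hF (j.+1, S j)].
- by move=> j; have [] := hF (j.+1, S j).
- by move=> j; have [] := hF (j.+1, S j).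
Qed.

(** Take the least [m] with [s < S m.+1]. Minimality gives [S m <= s], except when [m = k], where
    the hypothesis on [s] does. *)
Lemma block_exists (S : nat -> nat) k s : (forall j, (S j < S j.+1)%N) ->
  (S k <= s)%N -> exists m, [/\ (k <= m)%N, (S m <= s)%N & (s < S m.+1)%N].
Proof.
move=> Sinc kS; have leS : {homo S : i j / (i <= j)%N}.
  by apply: homo_leq => [//|y x z|i]; [exact: leq_trans|exact: ltnW].
have idS i : (i <= S i)%N by elim: i => // i; have := Sinc i; lia.
have ex : exists m, (s < S m.+1)%N by exists s; exact: idS.
case: (ex_minnP ex) => m sm mmin.
have km : (k <= m)%N by rewrite leqNgt; apply/negP => /leS; lia.
exists m; split => //; case: (eqVneq k m) => [<-//|nkm].
case: m sm mmin km nkm => [|m] sm mmin km nkm; first lia.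
by rewrite leqNgt; apply/negP => /mmin; lia.
Qed.

(* The glued function agrees with [d j] on the block between consecutive stages
   [N (S j)] and [N (S j.+1)]. The stages at least double the total weight, so
   the errors made on all earlier blocks sum to a geometric series dominated by
   the last one. *)
Lemma logmean_glue N (d : nat -> nat -> int -> R) (e : nat -> R) :
    (forall s, (0 < N s)%N) -> (forall s, (N s < N s.+1)%N) ->
    (forall j k n, 0 <= d j k n) -> (forall k, 0 < e k) ->
    (forall j k, (k <= j)%N -> \forall s \near \oo, logmean (N s) (d j k) <= e k) ->
  exists kap : int -> nat, forall k,
    \forall s \near \oo, logmean (N s) (fun n => d (kap n) k n) <= 4 * e k.
Proof.
move=> N0 Ninc d0 e0 de.
have idN i : (i <= N i)%N by elim: i => // i; have := Ninc i; lia.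
have leN : {homo N : i j / (i <= j)%N}.
  by apply: homo_leq => [//|y x z|i]; [exact: leq_trans|exact: ltnW].
have lwN C : \forall s \near \oo, C <= logweight (N s).
  have /cvgryPge/(_ C) [n0 _ hn0] := cvg_logweight.
  by exists n0 => // s /= ns; apply: hn0 => /=; exact: leq_trans (idN s).
pose P j s := forall k, (k <= j)%N ->
  logsum (N s) (d j k) <= e k * logweight (N s).
have nP j : \forall s \near \oo, P j s.
  (* Finitely many eventual bounds, one for each [k <= j], are intersected by induction on their
     number. *)
  suff H m : \forall s \near \oo, forall k, (k < m)%N -> (k <= j)%N ->
      logsum (N s) (d j k) <= e k * logweight (N s).
    by apply: filterS (H j.+1) => s + k kj; apply.
  elim: m => [|m IH]; first exact: nearW.
  have [mj|mj] := leqP m j; last first.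
    by apply: filterS IH => s + k km kj; apply => //; lia.
  apply: filterS2 IH (de j m mj) => s IH; rewrite logmean_leE// => dm k.
  by rewrite ltnS leq_eqVlt => /orP[/eqP -> //|]; exact: IH.
have [S [hP Sinc hw]] := stages nP (fun s => lwN (2 * logweight (N s))).
have leS : {homo S : i j / (i <= j)%N}.
  by apply: homo_leq => [//|y x z|i]; [exact: leq_trans|exact: ltnW].
have idS i : (i <= S i)%N by elim: i => // i; have := Sinc i; lia.
(* [kap n] is the least block whose right end reaches [|n|]. Block 0 thus also absorbs everything up
   to [N (S 0)], and the absolute value covers negative integers. *)
have /choice[kap hkap] (n : int) : exists m, (`|n| <= N (S m.+1))%N /\
    forall j, (`|n| <= N (S j.+1))%N -> (m <= j)%N.
  have ex : exists m, (`|n| <= N (S m.+1))%N.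
    by exists `|n|%N; have := idS `|n|.+1; have := idN (S `|n|.+1); lia.
  by case: (ex_minnP ex) => m hm mmin; exists m.
exists kap => k; pose a M := logsum M (fun n => d (kap n) k n).
have kapE m (n : nat) : (N (S m) < n <= N (S m.+1))%N -> kap n%:Z = m.
  move=> /andP[mn nm]; have [/= h1 h2] := hkap n%:Z.
  apply/eqP; rewrite eqn_leq h2//= leqNgt; apply/negP => /leS /leN.
  by lia.
(* Inside block [m] the glued summand is [d m k], whose whole sum up to [N s] is controlled because
   [s] is at least [S m]. *)
have step m s : (k <= m)%N -> (S m <= s)%N -> (s <= S m.+1)%N ->
    a (N s) <= a (N (S m)) + e k * logweight (N s).
  move=> km ms sm; apply: le_trans (_ : a (N (S m)) + logsum (N s) (d m k) <= _).
    apply: logsum_tail_le => //; first exact: leN.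
    move=> n /andP[n1 n2]; rewrite (kapE m)// n1/=.
    by apply: (leq_trans n2); exact: leN.
  by rewrite lerD2l; exact: hP.
(* The constant 2 reproduces itself: [2 * e k] times the old weight is at most [e k] times the new
   one, and the new block costs another [e k]. *)
have stage i : a (N (S (k + i)%N)) <=
    a (N (S k)) + 2 * e k * logweight (N (S (k + i)%N)).
  elim: i => [|i IH].
    rewrite addn0 lerDl mulr_ge0//; first by rewrite mulr_ge0// ltW.
    by rewrite ltW// logweight_gt0.
  rewrite addnS; apply: le_trans (step (k + i)%N _ _ (ltnW (Sinc _)) (leqnn _)) _.
    by rewrite leq_addr.
  have := hw (k + i)%N; have := e0 k; nra.
have near_s : \forall s \near \oo, (S k <= s)%N by exists (S k).
(* In units of [e k] times the weight, the sum up to stage [k] costs 1 for such [s], the complete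
   blocks after it cost 2 and the current block costs 1, whence the constant 4. *)
apply: filterS2 near_s (lwN (a (N (S k)) / e k)) => s ks aw.
rewrite logmean_leE// -/(a (N s)).
have [m [km ms sm]] := block_exists Sinc ks.
have /= := stage (m - k)%N; rewrite subnKC// => st.
have := step m s km ms (ltnW sm).
have mono : logweight (N (S m)) <= logweight (N s).
  rewrite /logweight (big_cat_nat (n := (N (S m)).+1) (p := (N s).+1))//=.
    by rewrite lerDl sumr_ge0// => i _; rewrite invr_ge0.
  by rewrite ltnS; exact: leN.
rewrite ler_pdivrMr// in aw.
by have := e0 k; nra.
Qed.
End Glue.

(** * Complex limits by real and imaginary parts, and mean squares *)

Section MeanSquare.
Variable R : realType.
Implicit Types (f g : int -> R[i]) (N : nat -> nat) (A : set (int -> R[i])).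

Lemma sqr_normcE (z : R[i]) : normc z ^+ 2 = complex.Re z ^+ 2 + complex.Im z ^+ 2.
Proof. by case: z => u v /=; rewrite sqr_sqrtr// addr_ge0// sqr_ge0. Qed.

Lemma normr_Re_le (z : R[i]) : `|complex.Re z| <= normc z.
Proof. by case: z => a b /=; rewrite -sqrtr_sqr ler_wsqrtr// lerDl sqr_ge0. Qed.

Lemma normr_Im_le (z : R[i]) : `|complex.Im z| <= normc z.
Proof. by case: z => a b /=; rewrite -sqrtr_sqr ler_wsqrtr// lerDr sqr_ge0. Qed.

Lemma normc_le_ReIm (z : R[i]) : normc z <= `|complex.Re z| + `|complex.Im z|.
Proof.
rewrite -[leRHS]ger0_norm ?addr_ge0// -sqrtr_sqr.
case: z => a b /=; rewrite ler_wsqrtr//.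
by rewrite sqrrD !real_normK ?num_real// addrAC lerDl mulrn_wge0// mulr_ge0.
Qed.

Lemma cvg_complexP (u : nat -> R[i]) (l : R[i]) :
  (u : nat -> R[i]^o) @ \oo --> (l : R[i]^o) <->
  (@complex.Re R \o u @ \oo --> complex.Re l) /\
  (@complex.Im R \o u @ \oo --> complex.Im l).
Proof.
have ReB (x y : R[i]) : complex.Re x - complex.Re y = complex.Re (x - y).
  by case: x y => ? ? [].
have ImB (x y : R[i]) : complex.Im x - complex.Im y = complex.Im (x - y).
  by case: x y => ? ? [].
split=> [/cvgrPdist_lt ul|[/cvgrPdist_lt ul /cvgrPdist_lt vl]].
  split; apply/cvgrPdist_lt => e e0; apply: filterS (ul (e%:C)%C _);
    rewrite ?ltcR// => s; rewrite ltcR /= ?ReB ?ImB; apply: le_lt_trans.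
  - exact: normr_Re_le.
  - exact: normr_Im_le.
(* The norm of [R[i]^o] takes values in [R[i]], so the tolerance is itself complex; positivity means
   zero imaginary part and positive real part. *)
apply/cvgrPdist_lt => e; rewrite ltcE => /andP[/= /eqP ie e0].
have e2 : 0 < complex.Re e / 2 by rewrite divr_gt0.
apply: filterS2 (ul _ e2) (vl _ e2) => s /=; rewrite ReB ImB => h1 h2.
rewrite ltcE/= ie eqxx/=.
by apply: le_lt_trans (normc_le_ReIm _) _; lra.
Qed.

Lemma conjcE (z : R[i]) : z^* = conjc z.
Proof. by []. Qed.

Lemma logweightC M : (\sum_(1 <= n < M.+1) n%:R^-1 : R[i]) = ((logweight R M)%:C)%C.
Proof.
rewrite /logweight rmorph_sum/=; apply: eq_bigr => i _.
by rewrite fmorphV/= rmorph_nat.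
Qed.

Lemma Re_mulr (z : R[i]) (x : R) : complex.Re (z * (x%:C)%C) = complex.Re z * x.
Proof. by case: z => a b /=; rewrite mulr0 subr0. Qed.

Lemma Im_mulr (z : R[i]) (x : R) : complex.Im (z * (x%:C)%C) = complex.Im z * x.
Proof. by case: z => a b /=; rewrite mulr0 add0r. Qed.

(** The weights are real, so they pass through the real part. *)
Lemma Re_logmean M f : complex.Re (logmean M f) = logmean M (@complex.Re R \o f).
Proof.
rewrite /logmean logweightC -fmorphV/= Re_mulr; congr (_ / _).
rewrite (big_morph (@complex.Re R) (id1 := 0) (op1 := +%R))//; last by case=> ? ? [].
apply: eq_bigr => i _.
by rewrite -[in LHS](rmorph_nat (real_complex R)) -fmorphV Re_mulr.
Qed.

Lemma Im_logmean M f : complex.Im (logmean M f) = logmean M (@complex.Im R \o f).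
Proof.
rewrite /logmean logweightC -fmorphV/= Im_mulr; congr (_ / _).
rewrite (big_morph (@complex.Im R) (id1 := 0) (op1 := +%R))//; last by case=> ? ? [].
apply: eq_bigr => i _.
by rewrite -[in LHS](rmorph_nat (real_complex R)) -fmorphV Im_mulr.
Qed.

Lemma logmean_cvgP N f l : logmean_cvg N f l <->
  ((fun s => logmean (N s) (@complex.Re R \o f)) @ \oo --> complex.Re l) /\
  ((fun s => logmean (N s) (@complex.Im R \o f)) @ \oo --> complex.Im l).
Proof.
rewrite /logmean_cvg cvg_complexP.
under [X in _ <-> (X @ _ --> _) /\ _]eq_fun do rewrite -Re_logmean.
by under [X in _ <-> _ /\ (X @ _ --> _)]eq_fun do rewrite -Im_logmean.
Qed.

Lemma logmean_cvg_unique N f l l' : 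
  logmean_cvg N f l -> logmean_cvg N f l' -> l = l'.
Proof.
move=> /logmean_cvgP[rl il] /logmean_cvgP[rl' il'].
apply/eqP; rewrite eq_complex; apply/andP; split; apply/eqP.
  exact: (cvg_unique _ rl rl').
exact: (cvg_unique _ il il').
Qed.

Lemma logmean_cvg_lin N (a b : R[i]) f g l m :
  logmean_cvg N f l -> logmean_cvg N g m ->
  logmean_cvg N (fun n => a * f n + b * g n) (a * l + b * m).
Proof.
move=> /cvg_complexP[/= rl il] /cvg_complexP[/= rm im].
have linE s : logmean (N s) (fun n => a * f n + b * g n) =
    a * logmean (N s) f + b * logmean (N s) g.
  rewrite /logmean !mulrA -mulrDl; congr (_ / _).
  rewrite !mulr_sumr -big_split/=; apply: eq_bigr => i _.
  by rewrite mulrDl !mulrA.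
have ReE x y : complex.Re (a * x + b * y) =
    complex.Re a * complex.Re x - complex.Im a * complex.Im x +
    (complex.Re b * complex.Re y - complex.Im b * complex.Im y).
  by case: a b x y {linE} => ? ? [? ?] [? ?] [].
have ImE x y : complex.Im (a * x + b * y) =
    complex.Re a * complex.Im x + complex.Im a * complex.Re x +
    (complex.Re b * complex.Im y + complex.Im b * complex.Re y).
  by case: a b x y {linE ReE} => ? ? [? ?] [? ?] [? ?].
apply/cvg_complexP; split.
  rewrite ReE (_ : @complex.Re R \o _ = fun s =>
    complex.Re a * complex.Re (logmean (N s) f) -
    complex.Im a * complex.Im (logmean (N s) f) +
    (complex.Re b * complex.Re (logmean (N s) g) -
    complex.Im b * complex.Im (logmean (N s) g))); last first.
    by apply/funext => s /=; rewrite linE ReE.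
  by apply: cvgD; apply: cvgB; apply: cvgM => //; exact: cvg_cst.
rewrite ImE (_ : @complex.Im R \o _ = fun s =>
  complex.Re a * complex.Im (logmean (N s) f) +
  complex.Im a * complex.Re (logmean (N s) f) +
  (complex.Re b * complex.Im (logmean (N s) g) +
  complex.Im b * complex.Re (logmean (N s) g))); last first.
  by apply/funext => s /=; rewrite linE ImE.
by apply: cvgD; apply: cvgD; apply: cvgM => //; exact: cvg_cst.
Qed.

Lemma logmean_cvg_conj N f l :
  logmean_cvg N f l -> logmean_cvg N (fun n => (f n)^*) l^*.
Proof.
move=> /logmean_cvgP[rl il]; apply/logmean_cvgP; rewrite !conjcE.
have -> : complex.Re (conjc l) = complex.Re l by case: l {rl il}.
have -> : complex.Im (conjc l) = - complex.Im l by case: l {rl il}.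
split.
  rewrite (_ : @complex.Re R \o _ = @complex.Re R \o f)//.
  by apply/funext => n /=; rewrite conjcE; case: (f n).
rewrite (_ : (fun s => _) = fun s => - logmean (N s) (@complex.Im R \o f)).
  exact: cvgN.
(* Negation is presented as [-1] times the mean plus [0] times the mean, so that [logmeanZD]
   applies. *)
apply/funext => s; rewrite -[RHS]mulN1r -[RHS]addr0.
rewrite -[in RHS](mul0r (logmean (N s) (@complex.Im R \o f))) -logmeanZD.
congr logmean; apply/funext => n /=.
by rewrite conjcE mul0r addr0 mulN1r; case: (f n).
Qed.

Definition meansq M f : R := logmean M (fun n => normc (f n) ^+ 2).

Lemma meansq_ge0 M f : 0 <= meansq M f.
Proof. by apply: logmean_ge0 => n; exact: sqr_ge0. Qed.

(** In each real coordinate the gap is [t^-1 * (t * x - y) ^+ 2]. The free parameter [t] brings the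
    coefficient of [f] as near to 1 as desired, which does the work of Minkowski's inequality. *)
Lemma meansqD_le M f g (t : R) : 0 < t ->
  meansq M (f + g) <= (1 + t) * meansq M f + (1 + t^-1) * meansq M g.
Proof.
move=> t0; rewrite /meansq -logmeanZD; apply: le_logmean => n.
rewrite (_ : (f + g) n = f n + g n)// !sqr_normcE.
case: (f n) (g n) => [a b] [c d] /=.
have H (x y : R) : (x + y) ^+ 2 <= (1 + t) * x ^+ 2 + (1 + t^-1) * y ^+ 2.
  have -> : (1 + t) * x ^+ 2 + (1 + t^-1) * y ^+ 2 = 
      (x + y) ^+ 2 + t^-1 * (t * x - y) ^+ 2.
    by field; rewrite gt_eqF.
  by rewrite lerDl mulr_ge0 ?sqr_ge0// invr_ge0 ltW.
by apply: le_trans (lerD (H a c) (H b d)) _; lra.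
Qed.

Lemma meansqN M f : meansq M (- f) = meansq M f.
Proof. by congr logmean; apply/funext => n; rewrite normcN. Qed.

End MeanSquare.

(** * Convergence of mean squares in script L^2(A, N) *)

Section Hilbert.
Variables (R : realType) (N : nat -> nat) (A : set (int -> R[i])).
Hypothesis (hA : Cstar_subalgebra A) (avgA : admits_log_averages A N).
Implicit Types (f g : int -> R[i]).

Local Notation meansq_cvg f l := ((fun s => meansq (N s) f) @ \oo --> (l : R)).

Lemma Cstar_meansq_cvg f : A f -> exists l, meansq_cvg f l.
Proof.
move=> Af; have [l /logmean_cvgP[lf _]] :=
  avgA (Cstar_mul hA Af (Cstar_conj hA Af)).
exists (complex.Re l); rewrite (_ : (fun s => _) =
  fun s => logmean (N s) (@complex.Re R \o (fun n => f n * (f n)^*)))//.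
apply/funext => s; congr logmean; apply/funext => n /=.
by rewrite sqr_normcE conjcE; case: (f n) => a b /=; rewrite mulrN opprK !expr2.
Qed.

Lemma is_L2_meansq_lt f : is_L2 A N f -> forall e, 0 < e ->
  exists2 g, A g & \forall s \near \oo, meansq (N s) (f - g) < e.
Proof.
move=> hf e e0; have [g Ag /limn_esup_lt_near lt] := hf e e0.
by exists g => //; apply: filterS lt => s; rewrite lte_fin.
Qed.

Lemma meansqD_le2 M f g : meansq M (f + g) <= 2 * meansq M f + 2 * meansq M g.
Proof. by apply: le_trans (meansqD_le M f g ltr01) _; rewrite invr1. Qed.

(** The means form a Cauchy sequence: for each [e] they eventually lie within [e] of the limit
    belonging to one approximant in [A]. *)
Lemma is_L2_meansq_cvg f : is_L2 A N f -> exists l, meansq_cvg f l.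
Proof.
move=> /is_L2_meansq_lt hf.
have [g1 Ag1 h1] := hf 1 ltr01; have [l1 /cvgrPdist_lt gl1] := Cstar_meansq_cvg Ag1.
(* From [|f|^2 <= 2 |f - g1|^2 + 2 |g1|^2], the two means on the right being eventually below 1 and
   [|l1| + 1]. *)
pose B := 2 * (`|l1| + 1) + 2.
have B0 : 0 < B by rewrite /B; have := normr_ge0 l1; lra.
have fB : \forall s \near \oo, meansq (N s) f <= B.
  apply: filterS2 h1 (gl1 _ ltr01) => s h1 h2.
  have := meansqD_le2 (N s) (f - g1) g1; rewrite subrK.
  have := ler_norm l1; rewrite ltr_norml in h2.
  by move: h2 => /andP[]; rewrite /B; lra.
suff : cvg ((fun s => meansq (N s) f) @ \oo) by move=> fl; eexists; exact: fl.
apply: cauchy_cvg; apply: cauchy_exP => e e0.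
(* This keeps [t] times either mean square within [e / 4]: that of [f] is at most [B], that of [g]
   at most [2 * B + 2]. The entry 1 of [d] serves the latter bound; the other entry keeps [1 + t^-1]
   times the error within [e / 4]. *)
pose t := e / (8 * (B + 1)).
have t0 : 0 < t by rewrite divr_gt0// mulr_gt0//; lra.
have ti0 : 0 < 1 + t^-1 by rewrite ltr_pwDl// invr_ge0 ltW.
pose d := Num.min 1 (e / 4 / (1 + t^-1)).
have d0 : 0 < d by rewrite lt_min ltr01/= !divr_gt0.
have [g Ag hg] := hf d d0; have [l /cvgrPdist_lt gl] := Cstar_meansq_cvg Ag.
have e2 : 0 < e / 2 by rewrite divr_gt0.
exists l; rewrite /fmap/=; apply: filterS3 fB hg (gl _ e2) => s fB fg gl' /=.
rewrite -ball_normE/=.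
have x1 := meansqD_le (N s) g (f - g) t0; rewrite addrC subrK in x1.
have x2 := meansqD_le (N s) f (g - f) t0; rewrite [f + _]addrC subrK in x2.
rewrite -(opprB f g) meansqN in x2.
have x3 := meansqD_le2 (N s) f (g - f); rewrite [f + _]addrC subrK in x3.
rewrite -(opprB f g) meansqN in x3.
have := meansq_ge0 (N s) f; have := meansq_ge0 (N s) g.
have := meansq_ge0 (N s) (f - g).
move: x1 x2 x3 fg gl' fB; rewrite lt_min ltr_pdivlMr// ltr_norml ltr_norml.
set x := meansq _ f; set y := meansq _ g; set h := meansq _ _.
move=> x1 x2 x3 /andP[h1' h2'] /andP[g1' g2'] fB' h0 y0 x0.
have tB : t * (8 * (B + 1)) = e by rewrite /t divfK// gt_eqF// mulr_gt0//; lra.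
have tx : t * x <= e / 4 by nra.
have ty : t * y <= e / 4 by nra.
by apply/andP; split; lra.
Qed.

(** A null difference contributes nothing to the limit of [meansqD_le], whatever [t] is. Used in
    both directions, this makes the limit independent of the representative. *)
Lemma meansq_cvg_le f g l m : meansq_cvg f l -> meansq_cvg g m ->
  is_null N (f - g) -> l <= m.
Proof.
move=> fl gm fg0.
have m0 : 0 <= m.
  by apply: (ler_cvg_to (cvg_cst 0) gm); apply: nearW => s; exact: meansq_ge0.
apply/ler_addgt0Pr => e e0.
(* With [t = e / (m + 1)] one gets [(1 + t) * m <= m + e]; the [+ 1] keeps the denominator positive
   when [m = 0]. *)
have t0 : 0 < e / (m + 1) by rewrite divr_gt0//; lra.
have : l <= (1 + e / (m + 1)) * m + (1 + (e / (m + 1))^-1) * 0.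
  apply: (ler_cvg_to fl) => [|/=]; first apply: cvgD.
  - by apply: cvgM => //; [exact: cvg_cst|exact: gm].
  - by apply: cvgM; [exact: cvg_cst|exact: fg0].
  - apply: nearW => s; have := meansqD_le (N s) g (f - g) t0.
    by rewrite [g + _]addrC subrK.
rewrite mulr0 addr0 mulrDl mul1r => /le_trans; apply; rewrite lerD2l.
by rewrite mulrAC ler_pdivrMr; nra.
Qed.

(** * The squared norm on the quotient *)

Lemma preL2P (f : preL2 N hA) : is_L2 A N f.
Proof. by apply/asboolP; exact: (valP f). Qed.

Definition L2_sqnorm (x : L2 N hA) : R :=
  limn (fun s => meansq (N s) (preL2_val (repr x))).

(** By [meansq_cvg_le] every representative gives the same limit as [repr], and the total function
    [limn] is here a genuine limit. *)
Lemma L2_sqnorm_cvg (f : preL2 N hA) : meansq_cvg f (L2_sqnorm (L2_class f)).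
Proof.
have [m fm] := is_L2_meansq_cvg (preL2P f).
have [l rl] := is_L2_meansq_cvg (preL2P (repr (L2_class f))).
have : L2_class (repr (L2_class f)) = L2_class f by exact: reprK.
move=> /[dup] /L2_class_eq rf /esym /L2_class_eq fr.
suff -> : L2_sqnorm (L2_class f) = m by [].
apply/eqP; rewrite /L2_sqnorm (cvg_lim _ rl)// eq_le.
by rewrite (meansq_cvg_le rl fm rf) (meansq_cvg_le fm rl fr).
Qed.
Arguments L2_sqnorm_cvg : clear implicits.

Lemma L2_sqnorm_ge0 x : 0 <= L2_sqnorm x.
Proof.
have [f <-] := L2_classP x.
by apply: (ler_cvg_to (cvg_cst 0) (L2_sqnorm_cvg f));
  apply: nearW => s; exact: meansq_ge0.
Qed.

Lemma L2_sqnormD_le x y : L2_sqnorm (x + y) <= 2 * L2_sqnorm x + 2 * L2_sqnorm y.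
Proof.
have [f <-] := L2_classP x; have [g <-] := L2_classP y; rewrite -L2_classD.
apply: (ler_cvg_to (L2_sqnorm_cvg _)) => [|/=]; first apply: cvgD.
- by apply: cvgM; [exact: cvg_cst|exact: L2_sqnorm_cvg].
- by apply: cvgM; [exact: cvg_cst|exact: L2_sqnorm_cvg].
- by apply: nearW => s; exact: meansqD_le2.
Qed.

(** * The inner product and its laws *)

Lemma L2_class_scale a (f : preL2 N hA) : L2_class (a *: f) = a *: L2_class f.
Proof. exact: L2_classZ. Qed.

Lemma L2_classB (f g : preL2 N hA) : L2_class (f - g) = L2_class f - L2_class g.
Proof. by rewrite -[- g]scaleN1r L2_classD L2_class_scale scaleN1r. Qed.

(* Polarization: [Re (f g^* )] and [Im (f g^* )] are recovered from
   [|f + g|^2] and [|f + i g|^2]. *)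
Definition L2_dot (x y : L2 N hA) : R[i] :=
  (((L2_sqnorm (x + y) - L2_sqnorm x - L2_sqnorm y) / 2) +i*
   ((L2_sqnorm (x + 'i%C *: y) - L2_sqnorm x - L2_sqnorm y) / 2))%C.

Lemma logmean_polar (h : int -> R) M (f g k : int -> R[i]) :
  (forall n, h n = (normc (k n) ^+ 2 - normc (f n) ^+ 2 - normc (g n) ^+ 2) / 2) ->
  logmean M h = (meansq M k - meansq M f - meansq M g) / 2.
Proof.
move=> hE.
transitivity (logmean M (fun n => 2^-1 * normc (k n) ^+ 2 + (- 2^-1) *
  (1 * normc (f n) ^+ 2 + 1 * normc (g n) ^+ 2))).
  by congr logmean; apply/funext => n; rewrite hE; ring.
by rewrite !logmeanZD /meansq; ring.
Qed.

(** Pointwise polarization turns each component into a combination of three convergent mean squares.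
    Linearity and symmetry below follow by uniqueness of limits. *)
Lemma logmean_cvg_dot (f g : preL2 N hA) :
  logmean_cvg N (fun n => f n * (g n)^*) (L2_dot (L2_class f) (L2_class g)).
Proof.
have polar (h : int -> R) (k : preL2 N hA) :
    (forall n, h n = (normc (k n) ^+ 2 - normc (f n) ^+ 2 - normc (g n) ^+ 2) / 2) ->
    (fun s => logmean (N s) h) @ \oo -->
    (L2_sqnorm (L2_class k) - L2_sqnorm (L2_class f) - L2_sqnorm (L2_class g)) / 2.
  move=> /(logmean_polar _) hE; under eq_fun do rewrite hE.
  apply: cvgM; last exact: cvg_cst.
  by apply: cvgB; [apply: cvgB|]; exact: L2_sqnorm_cvg.
apply/logmean_cvgP; split.
  rewrite /L2_dot/= -L2_classD; apply: polar => n.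
  rewrite (_ : preL2_val (f + g) n = f n + g n)// !sqr_normcE /= conjcE.
  by case: (f n) (g n) => [a b] [c d] /=; field.
rewrite /L2_dot/= -L2_class_scale -L2_classD; apply: polar => n.
rewrite (_ : preL2_val (f + _) n = f n + 'i%C * g n)// !sqr_normcE /= conjcE.
by case: (f n) (g n) => [a b] [c d] /=; field.
Qed.
Arguments logmean_cvg_dot : clear implicits.

Lemma L2_dot_diag x : L2_dot x x = ((L2_sqnorm x)%:C)%C.
Proof.
have [f <-] := L2_classP x.
have /logmean_cvgP[rl il] := logmean_cvg_dot f f.
apply/eqP; rewrite eq_complex; apply/andP; split; apply/eqP => /=.
  apply: cvg_unique rl _ => //; have := L2_sqnorm_cvg f.
  rewrite (_ : (fun s => _) = fun s => logmean (N s)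
    (@complex.Re R \o (fun n => f n * (f n)^*)))//.
  apply/funext => s; congr logmean; apply/funext => n /=.
  by rewrite sqr_normcE conjcE; case: (f n) => a b /=; ring.
apply: cvg_unique il _ => //.
rewrite (_ : (fun s => _) = cst 0); first exact: cvg_cst.
apply/funext => s; rewrite /logmean big1 ?mul0r// => i _ /=.
rewrite (_ : complex.Im _ = 0) ?mul0r// conjcE.
by case: (f _) => a b /=; ring.
Qed.

Lemma L2_dotDZl a x y z : L2_dot (a *: x + y) z = a * L2_dot x z + L2_dot y z.
Proof.
have [f <-] := L2_classP x; have [g <-] := L2_classP y; have [h <-] := L2_classP z.
rewrite -L2_class_scale -L2_classD.
apply: logmean_cvg_unique (logmean_cvg_dot _ _) _.
have := logmean_cvg_lin (a := a) (b := 1) (logmean_cvg_dot f h) (logmean_cvg_dot g h).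
rewrite mul1r; congr (logmean_cvg _ _ _); apply/funext => n.
by rewrite (_ : preL2_val (a *: f + g) n = a * f n + g n)// mulrDl mulrA mul1r.
Qed.

Lemma L2_dotC x y : L2_dot x y = (L2_dot y x)^*.
Proof.
have [f <-] := L2_classP x; have [g <-] := L2_classP y.
apply: logmean_cvg_unique (logmean_cvg_dot _ _) _.
have := logmean_cvg_conj (logmean_cvg_dot g f).
by congr (logmean_cvg _ _ _); apply/funext => n; rewrite rmorphM/= conjCK mulrC.
Qed.

(** Definiteness is built into the quotient: a vanishing squared norm says that a representative is
    null, hence equivalent to 0. *)
Lemma L2_dot_gt0 x : x != 0 -> 0 < L2_dot x x.
Proof.
move=> x0; rewrite L2_dot_diag ltcR lt_neqAle L2_sqnorm_ge0 andbT eq_sym.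
apply: contra_neq x0; have [f <-] := L2_classP x => f0.
have -> : 0 = L2_class (0 : preL2 N hA).
  by rewrite -[LHS](scale0r (L2_class f)) -L2_class_scale scale0r.
apply/L2_class_eq; have := L2_sqnorm_cvg f; rewrite f0 /is_null.
rewrite [X in _ -> X @ _ --> _](_ : _ = fun s => meansq (N s) f)//.
apply/funext => s; congr logmean; apply/funext => n.
by rewrite (_ : preL2_val (0 : preL2 N hA) n = 0) ?subr0.
Qed.

Lemma L2_dotBl z : {morph L2_dot^~ z : x y / x - y}.
Proof. by move=> x y; rewrite addrC -scaleN1r L2_dotDZl mulN1r addrC. Qed.

Lemma L2_dotBr z : {morph L2_dot z : x y / x - y}.
Proof. by move=> x y; rewrite L2_dotC L2_dotBl rmorphB/= -!L2_dotC. Qed.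

Lemma L2_dotZl a x y : L2_dot (a *: x) y = a * L2_dot x y.
Proof.
have L2_dot0l z : L2_dot 0 z = 0 by rewrite -(subrr 0) L2_dotBl subrr.
by rewrite -[a *: x]addr0 L2_dotDZl L2_dot0l addr0.
Qed.

Lemma L2_dotZr a x y : L2_dot x (a *: y) = a^* * L2_dot x y.
Proof. by rewrite L2_dotC L2_dotZl rmorphM/= -L2_dotC. Qed.

(** This puts the glued function in script L^2: an approximant in [A] of [f] also approximates [g].
    Two errors of [e / 8], each doubled, give [e / 2], which leaves room for the strict bound. *)
Lemma is_L2_near g : (forall e, 0 < e -> exists f : preL2 N hA,
    \forall s \near \oo, meansq (N s) (g - f) <= e) -> is_L2 A N g.
Proof.
move=> hg e e0.
have e8 : 0 < e / 8 by rewrite divr_gt0.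
have [f gf] := hg _ e8; have [h Ah fh] := is_L2_meansq_lt (preL2P f) e8.
exists h => //; apply: (@le_lt_trans _ _ (e / 2)%:E); last by rewrite lte_fin; lra.
apply: limn_esup_le_near; apply: filterS2 gf fh => s gf fh; rewrite lee_fin.
have := meansqD_le2 (N s) (g - f) (preL2_val f - h); rewrite subrKA.
by rewrite -/(meansq (N s) (g - h)); lra.
Qed.

(** * Completeness *)

Hypotheses (N_gt0 : forall s, (0 < N s)%N) (N_inc : forall s, (N s < N s.+1)%N).

Lemma L2_complete (u : nat -> L2 N hA) :
    (forall e : R, 0 < e -> exists n0, forall m n, (n0 <= m)%N -> (n0 <= n)%N ->
      L2_sqnorm (u m - u n) < e) ->
  exists l, forall e : R, 0 < e -> \forall n \near \oo, L2_sqnorm (u n - l) < e.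
Proof.
move=> uC; pose e k : R := k.+1%:R^-1.
have e0 k : 0 < e k by rewrite invr_gt0.
have /choice[phi0 hphi0] k := uC _ (e0 k).
(* A running maximum, so that [phi j] passes the Cauchy threshold of every [k <= j]. *)
pose phi k := (\max_(j < k.+1) phi0 j)%N.
have phi_ge j k : (k <= j)%N -> (phi0 k <= phi j)%N.
  by rewrite -ltnS => kj; exact: (leq_bigmax (Ordinal kj)).
pose F k := repr (u (phi k)).
have FE k : L2_class (F k) = u (phi k) by exact: reprK.
pose d j k n := normc (preL2_val (F j) n - preL2_val (F k) n) ^+ 2.
(* The limit of these means is strictly below [e k], and the margin gives the eventual bound. *)
have de j k : (k <= j)%N -> \forall s \near \oo, logmean (N s) (d j k) <= e k.
  move=> kj; have := L2_sqnorm_cvg (F j - F k).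
  rewrite L2_classB !FE => /cvgrPdist_lt.
  have du := hphi0 k _ _ (phi_ge j k kj) (phi_ge k k (leqnn k)).
  move=> /(_ (e k - L2_sqnorm (u (phi j) - u (phi k)))).
  rewrite subr_gt0 => /(_ du); apply: filterS => s.
  rewrite ltr_norml => /andP[+ _]; rewrite opprB ltrD2l ltrN2; exact: ltW.
have d0 j k n : 0 <= d j k n by exact: sqr_ge0.
have [kap hkap] := logmean_glue N_gt0 N_inc d0 e0 de.
pose g n := preL2_val (F (kap n)) n.
have small c : 0 < c -> exists k, e k < c.
  move=> c0; have /cvgrPdist_lt/(_ _ c0)[k _ /(_ k (leqnn k))] := @cvg_harmonic R.
  by rewrite /= sub0r normrN ger0_norm ?invr_ge0// => ?; exists k.
have gF k : \forall s \near \oo, meansq (N s) (g - F k) <= 4 * e k by exact: hkap.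
have gL2 : g \in L2_pred N hA.
  apply/asboolP; apply: is_L2_near => c c0.
  have [|k ek] := small (c / 4); first by rewrite divr_gt0.
  by exists (F k); apply: filterS (gF k) => s gFs; lra.
exists (L2_class (PreL2 gL2)) => c c0.
(* Here 10 is [2 * 1 + 2 * 4]: [e k] from the Cauchy property and [4 * e k] from the gluing, each
   doubled by [L2_sqnormD_le]. *)
have [|k ek] := small (c / 10); first by rewrite divr_gt0.
exists (phi0 k) => // n /= kn.
have un : L2_sqnorm (u n - u (phi k)) < e k by apply: hphi0 => //; exact: phi_ge.
have ug : L2_sqnorm (u (phi k) - L2_class (PreL2 gL2)) <= 4 * e k.
  have := L2_sqnorm_cvg (F k - PreL2 gL2).
  rewrite L2_classB FE.
  move=> /ler_cvg_to/(_ (cvg_cst _)); apply; apply: filterS (gF k) => s.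
  by rewrite -meansqN opprB.
by have := L2_sqnormD_le (u n - u (phi k)) (u (phi k) - L2_class (PreL2 gL2));
  rewrite subrKA; lra.
Qed.

End Hilbert.

Theorem theorem4p1 (R : realType) (N : nat -> nat) (A : set (int -> R[i]))
    (N_gt0 : forall s, (0 < N s)%N) (N_inc : forall s, (N s < N s.+1)%N)
    (hA : Cstar_subalgebra A) (avgA : admits_log_averages A N) :
  exists ip : {dot (L2 N hA) for (@Num.conj R[i])},
    (forall f g : preL2 N hA,
       logmean_cvg N (fun n => f n * (g n)^*) (ip (L2_class f) (L2_class g)))
    /\ hilbert ip.

Proof.
pose ip : {dot (L2 N hA) for (@Num.conj R[i])} := HB.pack (@L2_dot R N A hA)
  (isBilinear.Build R[i] (L2 N hA) (L2 N hA) R[i] *%R (Num.conj \; *%R)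
    (@L2_dot R N A hA) (L2_dotBl avgA) (L2_dotBr avgA)
    (fun y a x => L2_dotZl avgA a x y) (fun x a y => L2_dotZr avgA a x y))
  (* [false] selects the sign [+1], Hermitian rather than skew-Hermitian, hence the factor 1
     inserted by [mul1r]. *)
  (isHermitianSesquilinear.Build R[i] (L2 N hA) false Num.conj
    (@L2_dot R N A hA)
    (fun x y => etrans (L2_dotC avgA x y) (esym (mul1r _))))
  (isDotProduct.Build R[i] (L2 N hA) (@L2_dot R N A hA) (@L2_dot_gt0 R N A hA avgA)).
have ip_sqnorm x : complex.Re (ip x x) = L2_sqnorm x.
  by rewrite [ip x x](L2_dot_diag avgA).
exists ip; split; first exact: logmean_cvg_dot.
move=> u uC; have [e e0|l ul] := L2_complete avgA N_gt0 N_inc (u := u).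
  (* [L2_complete] speaks of squared norms, so tolerances pass through [Num.sqrt] here and through
     [e ^+ 2] on the way back. *)
  have [|n0 hn0] := uC (Num.sqrt e); first by rewrite sqrtr_gt0.
  exists n0 => m n nm nn; have := hn0 m n nm nn.
  by rewrite /dot_norm ip_sqnorm ltr_sqrt.
exists l; apply/cvgrPdist_lt => e e0.
apply: filterS (ul (e ^+ 2) _) => [n|]; last by rewrite exprn_gt0.
rewrite sub0r normrN ger0_norm /dot_norm ?sqrtr_ge0// ip_sqnorm => h.
by rewrite -[ltRHS]ger0_norm ?ltW// -sqrtr_sqr ltr_sqrt// exprn_gt0.
Qed.
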